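(* Let $K$ be a complete discretely valued field with uniformizer $\pi$ and residue field of characteristic different from $2$, and let $D=\left(\frac{a,\pi}{K}\right)$ be a quaternion division algebra over $K$ with $a\in\mathcal{O}_K^*$, with $K$-basis $1,x,y,z$ where $x^2=a$, $y^2=\pi$, $z=xy=-yx$ (the ramified case). Let $\sigma\in\{\tau,\tau_x,\tau_y\}$ and $\epsilon\in\{1,-1\}$. Let $\delta,\alpha,\beta,\gamma\in\mathcal{O}_K$ be such that $h=\langle\delta+\alpha x+\beta y+\gamma z\rangle$ is a one-dimensional ramified $\epsilon$-hermitian form over $(D,\sigma)$. Then $h\cong\langle\beta y+\gamma z\rangle$ as $\epsilon$-hermitian forms over $(D,\sigma)$.
   Context: $\mathcal{O}_K$ is the valuation ring of the normalized valuation $\nu_K$ of $K$. $\nu_D(d)=\frac12\nu_K(\mathrm{Nrd}(d))$ for $d\in D\setminus\{0\}$ is the extension of $\nu_K$ to $D$; here its value group is $\frac12\mathbb{Z}$. $\tau$ is the canonical (symplectic) involution of $D$: $\tau(x)=-x$, $\tau(y)=-y$, $\tau(z)=-z$. For $\lambda\in\{x,y\}$, $\tau_\lambda(d)=\lambda\tau(d)\lambda^{-1}$. For $u\in D^*$ with $\sigma(u)=\epsilon u$, $\langle u\rangle$ is the one-dimensional $\epsilon$-hermitian form $(d,d')\mapsto\sigma(d)ud'$ on $D$; thus $\langle u\rangle\cong\langle v\rangle$ iff $v=\sigma(t)ut$ for some $t\in D^*$. An $\epsilon$-hermitian form over $(D,\sigma)$ is called ramified if it is isometric to a diagonal form all of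 whose diagonal entries have $\nu_D$-value $\frac12$. *)

(* Defs.v *)
From HB Require Import structures.
From mathcomp Require Import all_boot all_order all_algebra.
From mathcomp Require Import ring.

Set Implicit Arguments.
Unset Strict Implicit.
Unset Printing Implicit Defensive.

Import Order.TTheory GRing.Theory Num.Theory.

Local Open Scope ring_scope.
Local Open Scope quotient_scope.

(* A normalized discrete valuation is a surjection from the nonzero elements of
   K to the integers; the value at 0 is irrelevant (see [val_ge]). *)
Record normalized_valuation (K : fieldType) := NormalizedValuation {
  valuation :> K -> int;
  valuationM : forall s t : K, s != 0 -> t != 0 ->
    valuation (s * t) = valuation s + valuation t;
  valuationD : forall s t : K, s != 0 -> t != 0 -> s + t != 0 ->
    Order.min (valuation s) (valuation t) <= valuation (s + t);
  valuation_surj : forall n : int, exists2 s : K, s != 0 & valuation s = n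
}.

Section Valuation.
Context {K : fieldType}.
Implicit Types (nu : normalized_valuation K) (s t : K).

(* nu s >= n, under the convention nu 0 = +oo. *)
Definition val_ge nu (n : int) s := (s == 0) || (n <= nu s).

Definition cauchy_seq nu (u : nat -> K) :=
  forall n : int, exists N : nat, forall i j : nat,
    (N <= i)%N -> (N <= j)%N -> val_ge nu n (u i - u j).

Definition cvg_seq nu (u : nat -> K) (l : K) :=
  forall n : int, exists N : nat, forall i : nat,
    (N <= i)%N -> val_ge nu n (u i - l).

Definition complete_valuation nu :=
  forall u : nat -> K, cauchy_seq nu u -> exists l : K, cvg_seq nu u l.

Definition uniformizer nu (p : K) := (p != 0) && (nu p == 1).

Definition valring nu : {pred K} := fun s => val_ge nu 0 s.

Definition valring_unit nu : {pred K} :=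
  [pred s | [&& s \in valring nu, s != 0 & s^-1 \in valring nu]].

Lemma valuation1 nu : nu 1 = 0.
Proof.
have := valuationM nu (oner_neq0 K) (oner_neq0 K).
by rewrite mulr1 => /eqP; rewrite -subr_eq subrr => /eqP <-.
Qed.

Lemma valuationN1 nu : nu (-1) = 0.
Proof.
have N1 : (-1 : K) != 0 by rewrite oppr_eq0 oner_neq0.
have := valuationM nu N1 N1; rewrite mulrNN mulr1 valuation1.
by move/eqP; rewrite -mulr2n eq_sym mulrn_eq0 /= => /eqP.
Qed.

Lemma val_geN nu n s : val_ge nu n s -> val_ge nu n (- s).
Proof.
rewrite /val_ge oppr_eq0; have [-> //|s0] := eqVneq s 0 => /=.
by rewrite -mulN1r valuationM ?oppr_eq0 ?oner_neq0// valuationN1 add0r.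
Qed.

Lemma val_geD nu n s t :
  val_ge nu n s -> val_ge nu n t -> val_ge nu n (s + t).
Proof.
rewrite /val_ge; have [->|s0] := eqVneq s 0; first by rewrite add0r.
have [->|t0] := eqVneq t 0; first by rewrite addr0 (negPf s0).
have [//|st0] /= := eqVneq (s + t) 0 => hs ht.
by apply: le_trans (valuationD nu s0 t0 st0); rewrite le_min hs.
Qed.

Lemma val_geM nu m n s t :
  val_ge nu m s -> val_ge nu n t -> val_ge nu (m + n) (s * t).
Proof.
rewrite /val_ge mulf_eq0.
have [//|s0] := eqVneq s 0; have [//|t0] := eqVneq t 0 => /= hs ht.
by rewrite valuationM// lerD.
Qed.

Fact valring_subring nu : subring_closed (valring nu).
Proof.
split=> [|s t hs ht|s t hs ht]; rewrite /valring unfold_in.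
- by rewrite /val_ge valuation1 lexx orbT.
- exact/val_geD/val_geN.
- by rewrite -[0]addr0; exact: val_geM.
Qed.
HB.instance Definition _ nu :=
  GRing.isSubringClosed.Build K (valring nu) (valring_subring nu).

Definition valring_type nu := {s : K | s \in valring nu}.
HB.instance Definition _ nu :=
  SubType.copy (valring_type nu) {s : K | s \in valring nu}.
HB.instance Definition _ nu := [Choice of valring_type nu by <:].
HB.instance Definition _ nu :=
  [SubChoice_isSubComNzRing of valring_type nu by <:].

Definition maxideal nu : {pred valring_type nu} :=
  fun s : valring_type nu => val_ge nu 1 (val s).
Arguments maxideal : clear implicits.

Fact maxideal_idealr nu : idealr_closed (maxideal nu).
Proof.
split=> [||c s t hs ht]; rewrite /maxideal unfold_in.
- by rewrite /val_ge rmorph0 eqxx.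
- by rewrite rmorph1 /val_ge oner_eq0 valuation1.
- rewrite rmorphD rmorphM; apply: val_geD => //.
  by rewrite -[1]add0r; apply: val_geM => //; exact: (valP c).
Qed.
HB.instance Definition _ nu :=
  isIdealr.Build (valring_type nu) (maxideal nu) (maxideal_idealr nu).

Definition residue_field nu : comNzRingType := {ideal_quot (maxideal nu)}.

Lemma residue_fieldP nu (r : residue_field nu) :
  r != 0 -> exists r', r' * r = 1.
Proof.
move: r; rewrite /residue_field => r.
rewrite -[r]reprK; set s := repr r.
rewrite !piE Quotient.equivE subr0 unfold_in /maxideal /val_ge negb_or -ltNge.
move=> /andP[s0 s1].
have sO : valuation nu (val s) = 0.
  apply/eqP; have := valP s; rewrite unfold_in /val_ge (negPf s0) /= => s2.
  by rewrite eq_le s2 andbT -ltzD1 add0r.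
have iO : (val s)^-1 \in valring nu.
  rewrite unfold_in /val_ge; apply/orP; right.
  have := valuationM nu s0 (invr_neq0 s0).
  by rewrite mulfV// valuation1 sO add0r => <-.
exists (\pi_{ideal_quot (maxideal nu)}
  (exist (fun c => c \in valring nu) _ iO : valring_type nu)).
rewrite !piE; congr (\pi _); apply: val_inj.
by rewrite rmorphM rmorph1 /= mulVf.
Qed.

End Valuation.

Arguments maxideal {K} nu.

(* The quaternion algebra (a, b / K) in characteristic not 2: [Quat s t u v]
   stands for s + t x + u y + v z with x^2 = a, y^2 = b and z = xy = -yx. *)
Record quat (K : fieldType) (a b : K) :=
  Quat { quat1 : K; quati : K; quatj : K; quatk : K }.

Section Quaternion.
Context {K : fieldType} {a b : K}.
Local Notation D := (quat a b).
Implicit Types (p q : D) (c : K).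

Definition quat_tuple q := (quat1 q, quati q, quatj q, quatk q).
Definition tuple_quat (t : K * K * K * K) : D :=
  let: (t0, t1, t2, t3) := t in Quat a b t0 t1 t2 t3.
Fact quat_tupleK : cancel quat_tuple tuple_quat. Proof. by case. Qed.
HB.instance Definition _ := Choice.copy D (can_type quat_tupleK).

Definition quat_zero : D := Quat a b 0 0 0 0.
Definition quat_opp p : D :=
  Quat a b (- quat1 p) (- quati p) (- quatj p) (- quatk p).
Definition quat_add p q : D :=
  Quat a b (quat1 p + quat1 q) (quati p + quati q)
           (quatj p + quatj q) (quatk p + quatk q).

Fact quat_addA : associative quat_add.
Proof. by move=> [????] [????] [????]; congr Quat => /=; ring. Qed.
Fact quat_addC : commutative quat_add.
Proof. by move=> [????] [????]; congr Quat => /=; ring. Qed.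
Fact quat_add0 : left_id quat_zero quat_add.
Proof. by move=> [????]; congr Quat => /=; ring. Qed.
Fact quat_addN : left_inverse quat_zero quat_opp quat_add.
Proof. by move=> [????]; congr Quat => /=; ring. Qed.
HB.instance Definition _ :=
  GRing.isZmodule.Build D quat_addA quat_addC quat_add0 quat_addN.

Definition quat_one : D := Quat a b 1 0 0 0.
Definition quat_mul p q : D :=
  let: Quat p0 p1 p2 p3 := p in
  let: Quat q0 q1 q2 q3 := q in
  Quat a b (p0 * q0 + a * (p1 * q1) + b * (p2 * q2) - a * b * (p3 * q3))
           (p0 * q1 + p1 * q0 - b * (p2 * q3) + b * (p3 * q2))
           (p0 * q2 + p2 * q0 + a * (p1 * q3) - a * (p3 * q1))
           (p0 * q3 + p3 * q0 + p1 * q2 - p2 * q1).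

Fact quat_mulA : associative quat_mul.
Proof. by move=> [????] [????] [????]; congr Quat => /=; ring. Qed.
Fact quat_mul1q : left_id quat_one quat_mul.
Proof. by move=> [????]; congr Quat => /=; ring. Qed.
Fact quat_mulq1 : right_id quat_one quat_mul.
Proof. by move=> [????]; congr Quat => /=; ring. Qed.
Fact quat_mulDl : left_distributive quat_mul +%R.
Proof. by move=> [????] [????] [????]; congr Quat => /=; ring. Qed.
Fact quat_mulDr : right_distributive quat_mul +%R.
Proof. by move=> [????] [????] [????]; congr Quat => /=; ring. Qed.
Fact quat_one_neq0 : quat_one != 0.
Proof. by apply/eqP => -[] /eqP; rewrite oner_eq0. Qed.
HB.instance Definition _ := GRing.Zmodule_isNzRing.Build D
  quat_mulA quat_mul1q quat_mulq1 quat_mulDl quat_mulDr quat_one_neq0.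

Definition quat_scale c q : D :=
  Quat a b (c * quat1 q) (c * quati q) (c * quatj q) (c * quatk q).

Fact quat_scaleA c c' q :
  quat_scale c (quat_scale c' q) = quat_scale (c * c') q.
Proof. by congr Quat => /=; ring. Qed.
Fact quat_scale1 : left_id 1 quat_scale.
Proof. by move=> [????]; congr Quat => /=; ring. Qed.
Fact quat_scaleDr : right_distributive quat_scale +%R.
Proof. by move=> c p q; congr Quat => /=; ring. Qed.
Fact quat_scaleDl q : {morph quat_scale^~ q : c c' / c + c'}.
Proof. by move=> c c'; congr Quat => /=; ring. Qed.
HB.instance Definition _ := GRing.Zmodule_isLmodule.Build K D
  quat_scaleA quat_scale1 quat_scaleDr quat_scaleDl.

Fact quat_scaleAl c p q : c *: (p * q) = (c *: p) * q.
Proof. by case: p q => [????] [????]; congr Quat => /=; ring. Qed.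
HB.instance Definition _ := GRing.Lmodule_isLalgebra.Build K D quat_scaleAl.
Fact quat_scaleAr c p q : c *: (p * q) = p * (c *: q).
Proof. by case: p q => [????] [????]; congr Quat => /=; ring. Qed.
HB.instance Definition _ := GRing.Lalgebra_isAlgebra.Build K D quat_scaleAr.

(* The canonical (symplectic) involution. *)
Definition quat_conj q : D :=
  Quat a b (quat1 q) (- quati q) (- quatj q) (- quatk q).

Definition Nrd q : K :=
  quat1 q ^+ 2 - a * quati q ^+ 2 - b * quatj q ^+ 2 + a * b * quatk q ^+ 2.

Lemma mulq_conj q : q * quat_conj q = (Nrd q)%:A.
Proof. by case: q => ????; congr Quat; rewrite /Nrd /=; ring. Qed.

Lemma mul_conjq q : quat_conj q * q = (Nrd q)%:A.
Proof. by case: q => ????; congr Quat; rewrite /Nrd /=; ring. Qed.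

Lemma NrdM p q : Nrd (p * q) = Nrd p * Nrd q.
Proof. by case: p q => [????] [????]; rewrite /Nrd /=; ring. Qed.

Lemma Nrd1 : Nrd 1 = 1.
Proof. by rewrite /Nrd /=; ring. Qed.

Definition quat_unit : pred D := fun q => Nrd q != 0.
Definition quat_inv q : D :=
  if quat_unit q then (Nrd q)^-1 *: quat_conj q else q.

Fact quat_mulVq : {in quat_unit, left_inverse 1 quat_inv *%R}.
Proof.
move=> q uq; rewrite /quat_inv ifT//.
by rewrite -scalerAl mul_conjq scalerA mulVf// scale1r.
Qed.
Fact quat_mulqV : {in quat_unit, right_inverse 1 quat_inv *%R}.
Proof.
move=> q uq; rewrite /quat_inv ifT//.
by rewrite -scalerAr mulq_conj scalerA mulVf// scale1r.
Qed.
Fact quat_unitP p q : q * p = 1 /\ p * q = 1 -> quat_unit p.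
Proof.
case=> _ /(congr1 Nrd); rewrite NrdM Nrd1 /quat_unit => pq1.
by apply/eqP => p0; move/eqP: pq1; rewrite p0 mul0r eq_sym oner_eq0.
Qed.
Fact quat_inv_out : {in [predC quat_unit], quat_inv =1 id}.
Proof. by move=> q uq; rewrite /quat_inv ifN. Qed.
HB.instance Definition _ := GRing.NzRing_hasMulInverse.Build D
  quat_mulVq quat_mulqV quat_unitP quat_inv_out.

Definition qx : D := Quat a b 0 1 0 0.
Definition qy : D := Quat a b 0 0 1 0.
Definition qz : D := qx * qy.

Lemma qx_sqr : qx * qx = a%:A.
Proof. by congr Quat => /=; ring. Qed.
Lemma qy_sqr : qy * qy = b%:A.
Proof. by congr Quat => /=; ring. Qed.
Lemma qyx : qy * qx = - qz.
Proof. by congr Quat => /=; ring. Qed.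
Lemma quatE q :
  q = (quat1 q)%:A + quati q *: qx + quatj q *: qy + quatk q *: qz.
Proof. by case: q => ????; congr Quat => /=; ring. Qed.

(* tau_lambda, for lambda in {x, y}. *)
Definition quat_conj_by (l d : D) : D := l * quat_conj d * l^-1.

(* The extension of nu to D, relevant at nonzero elements only. *)
Definition nuD (nu : normalized_valuation K) (d : D) : rat :=
  (nu (Nrd d))%:Q / 2.

End Quaternion.

Arguments qx {K a b}.
Arguments qy {K a b}.
Arguments qz {K a b}.

Definition division_ring (R : unitRingType) :=
  forall d : R, d != 0 -> d \is a GRing.unit.

(* Right D-spaces are modules over the converse ring D^c, so that the scalar
   product (d : D^c) *: v is v d.  The right D-spaces D and D^n are then D^c^o
   and 'rV[D^c]_n. *)
Section HermitianForms.
Context {K : fieldType} {D : unitAlgType K}.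
Variables (sigma : D -> D) (eps : K).

Definition eps_hermitian (V : lmodType D^c) (h : V -> V -> D) :=
  (forall v v' w, h (v + v') w = h v w + h v' w) /\
  (forall v w w', h v (w + w') = h v w + h v w') /\
  (forall (d : D) v w, h ((d : D^c) *: v) w = sigma d * h v w) /\
  (forall (d : D) v w, h v ((d : D^c) *: w) = h v w * d) /\
  (forall v w, sigma (h v w) = eps *: h w v) /\
  (forall v, (forall w, h v w = 0) -> v = 0).

Definition isometric (V W : lmodType D^c) (h : V -> V -> D)
    (g : W -> W -> D) :=
  exists f : {linear V -> W},
    bijective f /\ forall v w, g (f v) (f w) = h v w.

Definition eps_symmetric_unit (u : D) :=
  u \is a GRing.unit /\ sigma u = eps *: u.

(* <u> *)
Definition form1 (u : D) : D^c^o -> D^c^o -> D :=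
  fun d d' => sigma d * u * (d' : D).

(* <u_0, ..., u_(n-1)> *)
Definition diag_form (n : nat) (u : 'I_n -> D) :
    'rV[D^c]_n -> 'rV[D^c]_n -> D :=
  fun v w => \sum_(i < n) sigma (v 0 i) * u i * (w 0 i : D).

Definition ramified (val : D -> rat) (V : lmodType D^c) (h : V -> V -> D) :=
  eps_hermitian h /\
  exists (n : nat) (u : 'I_n -> D),
    (forall i, eps_symmetric_unit (u i) /\ val (u i) = 1 / 2) /\
    isometric h (diag_form u).

End HermitianForms.

(* Main.v *)
Require Import Defs.
From HB Require Import structures.
From mathcomp Require Import all_boot all_order all_algebra.
From mathcomp Require Import ring zify.

Set Implicit Arguments.
Unset Strict Implicit.
Unset Printing Implicit Defensive.

Import Order.TTheory GRing.Theory Num.Theory.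
Local Open Scope ring_scope.

(** Write u = w + e with w = beta y + gamma z and e = delta + alpha x.  The
    goal is an invertible s with sigma(s) w s = u: left multiplication by s is
    then an isometry from <u> to <w> ([isometric_form1]).

    Put q = w^-1 e.  Since q is again a combination of y and z, it is a pure
    quaternion, so q^2 is a scalar n, and n = - Nrd e / Nrd w.  Moreover u =
    w (1 + q), and 1 + q is symmetric for the involution adjoint to <w>; a
    square root s of 1 + q inside the commutative field K(q) is symmetric as
    well, hence sigma(s) w s = w s^2 = u ([hermitian_square]).  Such a root
    c + d q amounts to 2 c d = 1 and c^2 + n d^2 = 1 in K, which two
    extractions of square roots of 1-units solve as soon as n lies in the
    maximal ideal ([sqrt_system], from [hensel_sqrt]).

    That n has positive value is what ramification provides.  The nonzero
    values of s^2 - a t^2 have even valuation ([norm_form_val_even]), as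
    otherwise a would be a square and the quaternion algebra would have zero
    divisors.  Hence, unless these norms vanish, nu (Nrd e) is even and
    nu (Nrd w) is odd, Nrd w being up to sign pi times such a value.  An
    isometry to a diagonal form of ramified entries makes nu (Nrd u) odd
    ([ramified_form1_odd]), and Nrd u = Nrd w + Nrd e; so Nrd w is the
    dominant term of that sum.

    All three involutions act on the basis 1, x, y, z by signs
    ([involution_sign_conj]), so they respect the decomposition u = w + e, and
    both parts inherit the eps-symmetry of u. *)

(** * Square roots of 1-units *)

Section ValuationTheory.
Context {K : fieldType} (nu : normalized_valuation K).
Implicit Types s t : K.

Lemma val_ge_le m n s : n <= m -> val_ge nu m s -> val_ge nu n s.
Proof.
by move=> nm; rewrite /val_ge; case: eqP => //= _; exact: le_trans.
Qed.

Lemma val_geB n s t : val_ge nu n s -> val_ge nu n t -> val_ge nu n (s - t).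
Proof. by move=> hs ht; exact/val_geD/val_geN. Qed.

Lemma val_ge_eq0 s : (forall n, val_ge nu n s) -> s = 0.
Proof.
by move=> /(_ (nu s + 1)); rewrite /val_ge => /orP[/eqP//|]; lia.
Qed.

Lemma val_ge_neq0 n s : s != 0 -> val_ge nu n s = (n <= nu s).
Proof. by move=> /negPf s0; rewrite /val_ge s0. Qed.

Lemma valuationV s : s != 0 -> nu s^-1 = - nu s.
Proof.
move=> s0; have := valuationM nu s0 (invr_neq0 s0).
by rewrite mulfV// valuation1; lia.
Qed.

Lemma valuationX2 s : s != 0 -> nu (s ^+ 2) = 2 * nu s.
Proof. by move=> s0; rewrite expr2 valuationM//; lia. Qed.

Lemma valuationN s : s != 0 -> nu (- s) = nu s.
Proof.
by move=> s0; rewrite -mulN1r valuationM ?oppr_eq0 ?oner_eq0// valuationN1 add0r.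
Qed.

Lemma val_ge_div m s t : t != 0 ->
  val_ge nu m (s / t) = val_ge nu (m + nu t) s.
Proof.
move=> t0; rewrite /val_ge mulf_eq0 invr_eq0 (negPf t0) orbF.
by have [//|s0] /= := eqVneq; rewrite valuationM ?invr_eq0// valuationV//; lia.
Qed.

Lemma valring_unit_val s : s \in valring_unit nu -> s != 0 /\ nu s = 0.
Proof.
case/and3P => sO s0; rewrite !unfold_in !val_ge_neq0 ?invr_eq0// in sO *.
by rewrite valuationV//; lia.
Qed.

Hypothesis hchar : 2%N \notin [pchar (residue_field nu)].

(** A residue field of characteristic different from 2 means exactly that 2 is
    outside the maximal ideal. *)
Lemma not_val_ge2 : ~~ val_ge nu 1 2.
Proof.
apply: contra hchar => h2; rewrite inE /=.
have -> : (2%:R : residue_field nu) = \pi_(residue_field nu)%qT 2%:R.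
  by rewrite rmorph_nat.
rewrite -[0](rmorph0 (\pi_(residue_field nu)%qT)).
by rewrite !piE Quotient.equivE subr0 unfold_in /maxideal rmorph_nat.
Qed.

Lemma two_neq0 : (2 : K) != 0.
Proof. by apply: contra not_val_ge2 => /eqP ->; rewrite /val_ge eqxx. Qed.

Lemma valuation2 : nu 2 = 0.
Proof.
have := not_val_ge2; rewrite val_ge_neq0 ?two_neq0//.
have : val_ge nu 0 2 by apply: (val_geD (t := 1)); rewrite /val_ge valuation1 orbT.
by rewrite val_ge_neq0 ?two_neq0//; lia.
Qed.

Lemma val_ge_half n s : val_ge nu n (s / 2) = val_ge nu n s.
Proof. by rewrite val_ge_div ?two_neq0// valuation2 addr0. Qed.

(** Newton's iteration for the square root of [A], with the derivative 2 x
    frozen at its value at the starting point x = 1: convergence is then only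
    linear, but no division other than by 2 occurs. *)
Fixpoint sqrt_approx (A : K) (k : nat) : K :=
  if k is k'.+1 then sqrt_approx A k' - (sqrt_approx A k' ^+ 2 - A) / 2 else 1.

(** If x = 1 modulo the maximal ideal and E = x^2 - A, one step turns the error
    E into E (E / 4 - (x - 1)), whose value is larger by at least 1. *)
Lemma sqrt_approxP A k : val_ge nu 1 (A - 1) ->
  val_ge nu 1 (sqrt_approx A k - 1) /\
  val_ge nu k.+1%:Z (sqrt_approx A k ^+ 2 - A).
Proof.
move=> hA; elim: k => [|k [IH1 IH2]] /=.
  rewrite subrr {1}/val_ge eqxx expr1n; split=> //.
  by rewrite -opprB; exact: val_geN.
set x := sqrt_approx A k in IH1 IH2 *; set E := x ^+ 2 - A in IH2 *.
have E1 : val_ge nu 1 E by apply: val_ge_le IH2; lia.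
split.
  by rewrite addrAC; apply: val_geB; rewrite ?val_ge_half.
have -> : (x - E / 2) ^+ 2 - A = E * (E / 2 / 2 - (x - 1)).
  by rewrite /E; field; exact: two_neq0.
have -> : k.+2%:Z = k.+1%:Z + 1 by lia.
by apply: val_geM => //; apply: val_geB; rewrite ?val_ge_half.
Qed.

Lemma sqrt_approx_close A i j : val_ge nu 1 (A - 1) ->
  val_ge nu i.+1%:Z (sqrt_approx A (i + j) - sqrt_approx A i).
Proof.
move=> hA; elim: j => [|j IH]; first by rewrite addn0 subrr /val_ge eqxx.
rewrite addnS /= addrAC; apply: val_geB => //; rewrite val_ge_half.
by apply: val_ge_le (sqrt_approxP (i + j) hA).2; lia.
Qed.

Hypothesis hcomplete : complete_valuation nu.

(** The approximations form a Cauchy sequence, and their errors tend to 0. *)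
Lemma hensel_sqrt A : val_ge nu 1 (A - 1) ->
  exists2 r, r ^+ 2 = A & val_ge nu 1 (r - 1).
Proof.
move=> hA; have /hcomplete[l hl] : cauchy_seq nu (sqrt_approx A).
  move=> n; exists `|n|%N => i j hi hj.
  have close k : (`|n| <= k)%N ->
      val_ge nu n (sqrt_approx A k - sqrt_approx A `|n|).
    move=> hk; rewrite -(subnKC hk).
    by apply: val_ge_le (sqrt_approx_close _ _ hA); lia.
  have -> : sqrt_approx A i - sqrt_approx A j =
    (sqrt_approx A i - sqrt_approx A `|n|) -
    (sqrt_approx A j - sqrt_approx A `|n|) by ring.
  by apply: val_geB; exact: close.
have l1 : val_ge nu 1 (l - 1).
  have [N /(_ N (leqnn N)) hN] := hl 1.
  have -> : l - 1 = (sqrt_approx A N - 1) - (sqrt_approx A N - l) by ring.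
  exact/val_geB/hN/(sqrt_approxP N hA).1.
exists l => //; apply/eqP; rewrite -subr_eq0; apply/eqP/val_ge_eq0 => n.
have [N hN] := hl n; pose k := maxn N `|n|%N.
have hk : val_ge nu n (sqrt_approx A k - l) by apply: hN; rewrite leq_maxl.
have [x1 xA] := sqrt_approxP k hA.
set x := sqrt_approx A k in hk x1 xA.
have O1 : val_ge nu 0 1 by rewrite /val_ge valuation1 orbT.
have int_near1 y : val_ge nu 1 (y - 1) -> val_ge nu 0 y.
  by move=> hy; rewrite -[y](subrK 1); apply: val_geD => //; apply: val_ge_le hy.
have -> : l ^+ 2 - A = (x ^+ 2 - A) - (x - l) * (x + l) by ring.
apply: val_geB; first by apply: val_ge_le xA; rewrite /k; lia.
by rewrite -[n]addr0; apply: val_geM => //; apply: val_geD; exact: int_near1.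
Qed.

(** If the value of s^2 - a t^2 exceeded that of one of its two terms, the
    quotient of the terms would be a 1-unit, hence a square, and so would [a].
    The ultrametric inequality then leaves the value of one of the terms, and
    both terms have even value. *)
Lemma norm_form_val_even a s t : (forall r, r ^+ 2 != a) -> a != 0 ->
  nu a = 0 -> s ^+ 2 - a * t ^+ 2 != 0 ->
  exists k : int, nu (s ^+ 2 - a * t ^+ 2) = 2 * k.
Proof.
move=> nsq a0 va m0.
have [t0|t0] := eqVneq t 0.
  move: m0; rewrite t0 expr0n mulr0 subr0 expf_eq0 /= => s0.
  by exists (nu s); rewrite valuationX2.
have at0 : a * t ^+ 2 != 0 by rewrite mulf_neq0// expf_neq0.
have vat : nu (a * t ^+ 2) = 2 * nu t.
  by rewrite valuationM ?expf_neq0// valuationX2// va add0r.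
have [s0|s0] := eqVneq s 0.
  by exists (nu t); rewrite s0 expr0n sub0r valuationN.
have s20 : s ^+ 2 != 0 by rewrite expf_neq0.
have le_s : nu (s ^+ 2 - a * t ^+ 2) <= 2 * nu s.
  rewrite leNgt; apply/negP => lt_s.
  have [|r r2 _] := hensel_sqrt (A := a * t ^+ 2 / s ^+ 2).
    have -> : a * t ^+ 2 / s ^+ 2 - 1 = - ((s ^+ 2 - a * t ^+ 2) / s ^+ 2).
      by field.
    by apply: val_geN; rewrite val_ge_div// val_ge_neq0// valuationX2//; lia.
  have /eqP[] := nsq (r * s / t).
  by rewrite !exprMn r2; field; rewrite ?s0 ?t0.
have le_t : nu (s ^+ 2 - a * t ^+ 2) <= 2 * nu t.
  rewrite leNgt; apply/negP => lt_t.
  have [|r r2 _] := hensel_sqrt (A := s ^+ 2 / (a * t ^+ 2)).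
    have -> : s ^+ 2 / (a * t ^+ 2) - 1 = (s ^+ 2 - a * t ^+ 2) / (a * t ^+ 2).
      by field; rewrite ?a0 ?t0.
    by rewrite val_ge_div// val_ge_neq0// vat; lia.
  have r0 : r != 0.
    by rewrite -sqrf_eq0 r2 mulf_neq0 ?invr_eq0.
  have /eqP[] := nsq (s / (t * r)).
  by rewrite expr_div_n exprMn r2; field; rewrite ?s0 ?t0 ?a0.
have := valuationD nu s20 (t := - (a * t ^+ 2)).
rewrite oppr_eq0 valuationN// vat valuationX2// => /(_ at0 m0).
by rewrite ge_min => /orP[] h;
  [exists (nu s)|exists (nu t)]; apply/eqP; rewrite eq_le h andbT.
Qed.

(** Substituting d = 1 / (2 c) gives the biquadratic equation
    c^4 - c^2 + n / 4 = 0, solved by c^2 = (1 + f) / 2 with f^2 = 1 - n; taking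
    f close to 1 makes (1 + f) / 2 a 1-unit. *)
Lemma sqrt_system n : val_ge nu 1 n ->
  exists c d, 2 * (c * d) = 1 /\ c ^+ 2 + n * d ^+ 2 = 1.
Proof.
move=> n1.
have nu1 : ~~ val_ge nu 1 1 by rewrite val_ge_neq0 ?oner_eq0// valuation1.
have [|f f2 f1] := hensel_sqrt (A := 1 - n).
  by rewrite addrAC subrr sub0r; exact: val_geN.
have [|c c2 c1] := hensel_sqrt (A := 1 + (f - 1) / 2).
  by rewrite addrAC subrr add0r val_ge_half.
have c0 : c != 0.
  apply: contra nu1 => /eqP c0; move: c1.
  by rewrite c0 sub0r => /val_geN; rewrite opprK.
have h2 := two_neq0.
have en : n = 1 - f ^+ 2 by rewrite f2; ring.
have ef : f = 2 * c ^+ 2 - 1 by rewrite c2; field.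
exists c, (2 * c)^-1; split; first by field; rewrite c0.
by rewrite en ef; field; rewrite c0.
Qed.

End ValuationTheory.

(** * Rescaling one-dimensional forms *)

Section Forms.
Context {K : fieldType} {D : unitAlgType K}.
Implicit Types (sigma : D -> D) (s : D).

(** Left multiplication commutes with the right action of D on itself, which is
    the scaling of D^c^o. *)
Definition lmulc s : D^c^o -> D^c^o := fun d => s * (d : D).

Fact lmulc_linear s : linear (lmulc s).
Proof. by move=> c u v; rewrite /lmulc [LHS]mulrDr mulrA. Qed.
HB.instance Definition _ s :=
  GRing.isLinear.Build D^c D^c^o D^c^o _ (lmulc s) (lmulc_linear s).

Lemma isometric_form1 sigma s u :
  (forall p q, sigma (p * q) = sigma q * sigma p) -> s \is a GRing.unit ->
  isometric (form1 sigma (sigma s * u * s)) (form1 sigma u).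
Proof.
move=> sigmaM us; exists (lmulc s); split.
  exists (lmulc s^-1) => d; [exact: (mulKr us d)|exact: (mulVKr us d)].
by move=> d d'; rewrite /form1 /= /lmulc sigmaM !mulrA.
Qed.

(** Because w q = e and both w and e are eps-symmetric, sigma(q) w = e too;
    expanding the product for s = d q + c gives
    d^2 (e q) + 2 c d e + c^2 w, where e q = w q^2 = n w. *)
Lemma hermitian_square sigma (eps c d n : K) (w e q : D) :
  (forall p p', sigma (p * p') = sigma p' * sigma p) -> linear sigma ->
  sigma 1 = 1 -> eps ^+ 2 = 1 -> sigma w = eps *: w -> sigma e = eps *: e ->
  w * q = e -> q * q = n%:A -> 2 * (c * d) = 1 -> c ^+ 2 + n * d ^+ 2 = 1 ->
  sigma (d *: q + c%:A) * w * (d *: q + c%:A) = w + e.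
Proof.
move=> sigmaM sigmaL sigma1 eps2 sw se wq qq cd cdn.
have sc : sigma c%:A = c%:A.
  have s0 : sigma 0 = 0.
    by have := sigmaL (-1) 0 0; rewrite scaler0 addr0 scaleN1r addNr.
  by have := sigmaL c 1 0; rewrite !addr0 s0 addr0 sigma1.
have sqw : sigma q * w = e.
  have := congr1 sigma wq; rewrite sigmaM sw se -scalerAr.
  by move=> /(congr1 (fun z => eps *: z)); rewrite !scalerA -expr2 eps2 !scale1r.
rewrite sigmaL sc mulrDl -scalerAl sqw mulrDr !mulrDl.
rewrite -!(scalerAl, scalerAr) !(mul1r, mulr1) !scalerA.
rewrite wq -[in e * q]wq -mulrA qq -scalerAr mulr1 scalerA.
rewrite [_ *: e + _ *: w]addrC addrACA -!scalerDl.
have -> : d * d * n + c * c = 1 by rewrite -cdn; ring.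
have -> : d * c + d * c = 1 by rewrite -cd; ring.
by rewrite !scale1r.
Qed.

End Forms.

(** * Involutions and quotients of quaternions *)

Section Quaternions.
Context {K : fieldType} {a b : K}.
Local Notation D := (quat a b).
Implicit Types p q : D.

(** The sign on z is forced by those on x and y: z = x y = - y x is sent to
    (s2 y) (s1 x) = - s1 s2 z by an anti-automorphism. *)
Definition sign_conj (s1 s2 : K) q : D :=
  Quat a b (quat1 q) (s1 * quati q) (s2 * quatj q) (- (s1 * s2) * quatk q).

Lemma sign_conjM s1 s2 p q : s1 ^+ 2 = 1 -> s2 ^+ 2 = 1 ->
  sign_conj s1 s2 (p * q) = sign_conj s1 s2 q * sign_conj s1 s2 p.
Proof.
case: p q => [????] [????].
move=> /eqP; rewrite sqrf_eq1 => /orP[]/eqP-> /eqP;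
  by rewrite sqrf_eq1 => /orP[]/eqP->; congr Quat => /=; ring.
Qed.

Lemma sign_conjL s1 s2 : linear (sign_conj s1 s2).
Proof. by move=> c p q; congr Quat => /=; ring. Qed.

Lemma sign_conj1 s1 s2 : sign_conj s1 s2 1 = 1.
Proof. by congr Quat => /=; ring. Qed.

Lemma Nrd_sign_conj s1 s2 q : s1 ^+ 2 = 1 -> s2 ^+ 2 = 1 ->
  Nrd (sign_conj s1 s2 q) = Nrd q.
Proof.
by move=> h1 h2; rewrite /Nrd /= !exprMn sqrrN exprMn h1 h2 !mul1r.
Qed.

Lemma conj_by_eq (l d r : D) : l \is a GRing.unit ->
  l * quat_conj d = r * l -> quat_conj_by l d = r.
Proof. by move=> ul e; rewrite /quat_conj_by e mulrK. Qed.

Lemma involution_sign_conj (sigma : D -> D) : division_ring D ->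
  sigma = quat_conj \/ sigma = quat_conj_by qx \/ sigma = quat_conj_by qy ->
  exists s1 s2, [/\ s1 ^+ 2 = 1, s2 ^+ 2 = 1 & sigma =1 sign_conj s1 s2].
Proof.
move=> hD.
have ux : (qx : D) \is a GRing.unit.
  by apply: hD; apply/eqP => -[] /eqP; rewrite oner_eq0.
have uy : (qy : D) \is a GRing.unit.
  by apply: hD; apply/eqP => -[] /eqP; rewrite oner_eq0.
case=> [->|[]->]; [exists (-1), (-1)|exists (-1), 1|exists 1, (-1)];
  split=> [||q]; rewrite ?sqrrN ?expr1n//.
- by congr Quat => /=; ring.
- by apply: conj_by_eq => //; case: q => ????; congr Quat => /=; ring.
- by apply: conj_by_eq => //; case: q => ????; congr Quat => /=; ring.
Qed.

(** If r^2 = a, then x + r is a zero divisor, as (x + r) (x - r) = 0. *)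
Lemma division_nonsquare r : division_ring D -> r ^+ 2 != a.
Proof.
move=> hD; apply/eqP => ra.
have /hD : (Quat a b r 1 0 0 : D) != 0.
  by apply/eqP => -[_] /eqP; rewrite oner_eq0.
by apply/negP; rewrite negbK /Nrd /= ra; apply/eqP; ring.
Qed.

(** Conjugation by x negates both y and z, so w, and with it w^-1 e,
    anticommutes with x; hence w^-1 e is a pure quaternion, and those square to
    minus their norm. *)
Lemma quat_split_quotient (delta alpha beta gamma : K)
    (w := Quat a b 0 0 beta gamma) (e := Quat a b delta alpha 0 0) :
  Nrd w != 0 ->
  exists q : D, w * q = e /\ q * q = (- (Nrd e / Nrd w))%:A.
Proof.
move=> w0; exists ((Nrd w)^-1 *: (quat_conj w * e)); split.
  by rewrite -scalerAr mulrA mulq_conj -scalerAl mul1r scalerA mulVf// scale1r.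
rewrite -scalerAr -scalerAl scalerA.
have -> : (quat_conj w * e) * (quat_conj w * e) = (- (Nrd e * Nrd w))%:A.
  by congr Quat; rewrite /Nrd /=; ring.
by rewrite scalerA; congr (_ *: _); field.
Qed.

End Quaternions.

(** * Ramified forms *)

(** The diagonal entry v_0 is represented by the form <u>: it equals
    sigma(t) u t, where t is the preimage of the first basis vector under the
    isometry.  Thus Nrd v_0 = Nrd(t)^2 Nrd u, and nu (Nrd v_0) = 1. *)
Lemma ramified_form1_odd (K : fieldType) (nu : normalized_valuation K) (a b : K)
    (sigma : quat a b -> quat a b) (eps : K) (u : quat a b) :
  (forall q, Nrd (sigma q) = Nrd q) -> sigma 1 = 1 -> sigma 0 = 0 ->
  ramified sigma eps (nuD nu) (form1 sigma u) ->
  Nrd u != 0 /\ exists k : int, nu (Nrd u) = 2 * k + 1.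
Proof.
move=> sN s1 s0 [_ [n [v [hv [f [[g fK gK] hf]]]]]].
(* The isometry forbids an empty diagonal, as D is not the zero module. *)
case: n v hv f g fK gK hf => [|n] v hv f g fK gK hf.
  case/eqP: (oner_neq0 (quat a b)); apply: (can_inj fK);
    rewrite [LHS]thinmx0 [RHS]thinmx0; reflexivity.
have [[/= uv0 _] hv0] := hv ord0.
have v0 : Nrd (v ord0) != 0 by [].
set t : quat a b := g (delta_mx ord0 ord0).
have ht : sigma t * u * t = v ord0.
  have := hf t t; rewrite gK /form1 => <-.
  rewrite /diag_form (bigD1 ord0)//= big1 ?addr0.
    by rewrite mxE eqxx s1 mul1r mulr1.
  by move=> i /negPf i0; rewrite mxE i0 s0 !mul0r.
have hN : Nrd t * Nrd u * Nrd t = Nrd (v ord0) by rewrite -ht !NrdM sN.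
have [t0 u0] : Nrd t != 0 /\ Nrd u != 0.
  by apply/andP; move: v0; rewrite -hN !mulf_eq0 !negb_or => /andP[/andP[-> ->]].
split=> //; exists (- nu (Nrd t)).
have : nu (Nrd (v ord0)) = 1.
  move: hv0; rewrite /nuD => /(congr1 (fun r => r * 2)).
  by rewrite !divfK// => /eqP; rewrite (eqr_int _ _ 1) => /eqP.
rewrite -hN !valuationM ?mulf_neq0//; lia.
Qed.

Theorem lemma4p5
  (K : fieldType) (nu : normalized_valuation K)
  (hcomplete : complete_valuation nu)
  (hchar : 2%N \notin [pchar (residue_field nu)])
  (pi a : K) (hpi : uniformizer nu pi) (ha : a \in valring_unit nu)
  (hD : division_ring (quat a pi))
  (sigma : quat a pi -> quat a pi)
  (hsigma : sigma = quat_conj \/ sigma = quat_conj_by qx \/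
            sigma = quat_conj_by qy)
  (eps : K) (heps : eps = 1 \/ eps = -1)
  (delta alpha beta gamma : K)
  (hdelta : delta \in valring nu) (halpha : alpha \in valring nu)
  (hbeta : beta \in valring nu) (hgamma : gamma \in valring nu)
  (hunit : eps_symmetric_unit sigma eps
             (delta%:A + alpha *: qx + beta *: qy + gamma *: qz))
  (hram : ramified sigma eps (nuD nu)
            (form1 sigma
               (delta%:A + alpha *: qx + beta *: qy + gamma *: qz))) :
  eps_symmetric_unit sigma eps (beta *: qy + gamma *: qz) /\
  isometric
    (form1 sigma (delta%:A + alpha *: qx + beta *: qy + gamma *: qz))
    (form1 sigma (beta *: qy + gamma *: qz)).
Proof.
have [s1 [s2 [s1E s2E sE]]] := involution_sign_conj hD hsigma.
have sM p q : sigma (p * q) = sigma q * sigma p by rewrite !sE sign_conjM.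
have sL : linear sigma by move=> c p q; rewrite !sE sign_conjL.
have s_1 : sigma 1 = 1 by rewrite sE sign_conj1.
have s_0 : sigma 0 = 0 by rewrite sE; congr Quat => /=; ring.
have sN q : Nrd (sigma q) = Nrd q by rewrite sE Nrd_sign_conj.
have eps2 : eps ^+ 2 = 1 by case: heps => ->; rewrite ?sqrrN expr1n.
have [u0 [k hk]] := ramified_form1_odd sN s_1 s_0 hram.
case: hunit => uu su.
set u := delta%:A + _ + _ + _ in uu su u0 hk *; set w := beta *: qy + _.
have wE : w = Quat a pi 0 0 beta gamma by rewrite /w; congr Quat => /=; ring.
pose e := Quat a pi delta alpha 0 0.
have uE : u = w + e by rewrite wE /u; congr Quat => /=; ring.
have [se sw] : sigma e = eps *: e /\ sigma w = eps *: w.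
  move: su; rewrite uE wE !sE => -[/= h1 h2 h3 h4].
  rewrite !addr0 in h3 h4; rewrite !add0r in h1 h2.
  by split; congr Quat => //=; rewrite !mulr0.
have [a0 va] := valring_unit_val ha.
have /andP[pi0 /eqP vpi] := hpi.
have nsq r : r ^+ 2 != a := division_nonsquare r hD.
have even s t := norm_form_val_even hchar hcomplete (s := s) (t := t) nsq a0 va.
have NwE : Nrd w = - (pi * (beta ^+ 2 - a * gamma ^+ 2)).
  by rewrite wE /Nrd /=; ring.
have NeE : Nrd e = delta ^+ 2 - a * alpha ^+ 2 by rewrite /Nrd /=; ring.
have NuE : Nrd u = Nrd w + Nrd e by rewrite uE wE /Nrd /=; ring.
have evenNe : Nrd e != 0 -> exists i : int, nu (Nrd e) = 2 * i.
  by rewrite NeE; exact: even.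
have oddNw : Nrd w != 0 -> exists i : int, nu (Nrd w) = 2 * i + 1.
  rewrite NwE oppr_eq0 => w0; rewrite valuationN//.
  move: w0; rewrite mulf_eq0 negb_or => /andP[_ m0].
  by rewrite valuationM// vpi; have [i ->] := even _ _ m0; exists i; lia.
have w0 : Nrd w != 0.
  apply/eqP => w0; move: u0 hk; rewrite NuE w0 add0r => /evenNe[i ->]; lia.
have n1 : val_ge nu 1 (- (Nrd e / Nrd w)).
  apply: val_geN; rewrite val_ge_div//; have [e0|e0] := eqVneq (Nrd e) 0.
    by rewrite e0 /val_ge eqxx.
  rewrite val_ge_neq0//; have [i vw] := oddNw w0; have [j ve] := evenNe e0.
  rewrite ve vw; suff : ~ (j <= i) by lia.
  have := valuationD nu w0 e0; rewrite -NuE => /(_ u0).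
  (* If nu (Nrd e) were below nu (Nrd w), it would equal nu (Nrd u), which is
     odd. *)
  have eE : Nrd e = Nrd u - Nrd w by rewrite NuE addrAC subrr add0r.
  have := valuationD nu u0 (t := - Nrd w).
  rewrite oppr_eq0 valuationN// -eE => /(_ w0 e0).
  by rewrite ve vw hk !ge_min; lia.
have [q [wq qq]] : exists q, w * q = e /\ q * q = (- (Nrd e / Nrd w))%:A.
  by move: w0; rewrite wE; exact: quat_split_quotient.
have [c [d [cd cdn]]] := sqrt_system hchar hcomplete n1.
have := hermitian_square sM sL s_1 eps2 sw se wq qq cd cdn.
rewrite -uE => <-; split=> //; apply: isometric_form1 => //.
have : Nrd (sigma (d *: q + c%:A) * w * (d *: q + c%:A)) != 0.
  by rewrite (hermitian_square sM sL s_1 eps2 sw se wq qq cd cdn) -uE.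
by rewrite NrdM mulf_eq0 negb_or => /andP[].
Qed.
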